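(* Let $X_1$ and $X_2$ be fuzzy incidence graphs such that the composition $X=X_1[X_2]$ is a strong fuzzy incidence graph. Let $D_1$ and $D_2$ be strong incidence dominating sets of $X_1$ and $X_2$ respectively. Then $D_1\times D_2$ is a strong incidence dominating set of $X$, and $\gamma_{IS}(X)\le W(D_1\times D_2)$.
   Context: Fuzzy incidence graphs. All graphs are finite, simple and undirected; $\wedge$ denotes minimum. A fuzzy incidence graph (FIG) $X=(V,E,I,\varepsilon,\rho,\eta)$ consists of a nonempty finite vertex set $V$, a set $E$ of edges $xy=yx$ ($x\neq y$ in $V$), a set $I$ of (incidence) pairs $(x,xy)$ with $xy\in E$ and $x$ an endpoint of $xy$, and functions $\varepsilon:V\to(0,1]$, $\rho:E\to(0,1]$, $\eta:I\to(0,1]$ with $\rho(xy)\le\varepsilon(x)\wedge\varepsilon(y)$ for all $xy\in E$ and $\eta(x,xy)\le\varepsilon(x)\wedge\rho(xy)$ for all $(x,xy)\in I$ (vertices, edges, pairs of weight $0$ are regarded as absent). The number $\eta(x,xy)$ is the weight of the pair $(x,xy)$. Strong pairs. For $(a,ab)\in I$, an incidence path from $a$ to $ab$ in $X\setminus(a,ab)$ is a sequence $x_0=a,(x_0,x_0x_1),x_0x_1,(x_1,x_0x_1),x_1,\dots,x_k=b,(b,ab),ab$ with $k\ge2$, the vertices $x_0,\dots,x_k$ distinct, and all listed edges in $E$ and pairs in $I$; its incidence strength is the minimum weight of its pairs. $ICONN_{X\setminus(a,ab)}(a,ab)$ is the maximum incidence strength over all such paths ($0$ if there are none). The pair $(a,ab)$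 is strong if $\eta(a,ab)\ge ICONN_{X\setminus(a,ab)}(a,ab)$. A strong fuzzy incidence graph (SFIG) is a FIG all of whose pairs are strong. Domination. In a FIG $X$, a vertex $y$ is a strong incidence neighbor of $x$ if $xy\in E$ and both $(x,xy),(y,xy)$ are in $I$ and strong; $N_{IS}(x)$ is the set of strong incidence neighbors of $x$. A set $D\subseteq V$ is a strong incidence dominating set (SIDS) if every $x\in V\setminus D$ is a strong incidence neighbor of some $y\in D$. Its weight is $W(D)=\sum_{x\in D}\min_{y\in N_{IS}(x)}\eta(x,xy)$ (a vertex with $N_{IS}(x)=\emptyset$ contributes $0$). The strong incidence domination number $\gamma_{IS}(X)$ is the minimum weight of a SIDS of $X$. Composition. For FIGs $X_i=(V_i,E_i,I_i,\varepsilon_i,\rho_i,\eta_i)$, $i=1,2$, the composition $X_1[X_2]=(V,E,I,\varepsilon,\rho,\eta)$ has $V=V_1\times V_2$; $E=\{(a_1,b_1)(a_2,b_2): a_1=a_2,\ b_1b_2\in E_2\ \text{or}\ a_1a_2\in E_1\}$; $I$ is the set of pairs $((a_1,b_1),(a_1,b_1)(a_2,b_2))$ such that either $a_1=a_2$ and both $(b_1,b_1b_2),(b_2,b_1b_2)\in I_2$, or both $(a_1,a_1a_2),(a_2,a_1a_2)\in I_1$; $\varepsilon(a,b)=\varepsilon_1(a)\wedge\varepsilon_2(b)$; $\rho((a_1,b_1)(a_2,b_2))$ equals $\varepsilon_1(a_1)\wedge\rho_2(b_1b_2)$ if $a_1=a_2$, $\rho_1(a_1a_2)\wedge\varepsilon_2(b_1)$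 if $a_1a_2\in E_1,b_1=b_2$, and $\rho_1(a_1a_2)\wedge\varepsilon_2(b_1)\wedge\varepsilon_2(b_2)$ if $a_1a_2\in E_1,b_1\ne b_2$; $\eta((a_1,b_1),(a_1,b_1)(a_2,b_2))$ equals $\varepsilon_1(a_1)\wedge\eta_2(b_1,b_1b_2)$ if $a_1=a_2$, $\eta_1(a_1,a_1a_2)\wedge\varepsilon_2(b_1)$ if $a_1\ne a_2,b_1=b_2$, and $\eta_1(a_1,a_1a_2)\wedge\varepsilon_2(b_1)\wedge\varepsilon_2(b_2)$ if $a_1\neq a_2,b_1\ne b_2$. In the claim, $W$ is the weight in $X_1[X_2]$. *)

(* Defs.v *)
From mathcomp Require Import all_boot all_order all_algebra.
From mathcomp Require Import reals.

Set Implicit Arguments.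
Unset Strict Implicit.
Unset Printing Implicit Defensive.

Import Order.TTheory GRing.Theory Num.Theory.
Local Open Scope ring_scope.

(* [fedge X x y] means xy \in E, and [finc X x y] means (x, xy) \in I; the pair
   at the other end of the same edge, (y, xy), is [finc X y x].  The weights
   [frho X x y] of xy and [feta X x y] of (x, xy) are only constrained, and only
   ever used, on E and on I respectively. *)
Record fig (R : realType) (V : finType) := Fig {
  fedge : rel V;
  finc : rel V;
  feps : V -> R;
  frho : V -> V -> R;
  feta : V -> V -> R;
  fig_nonempty : (0 < #|V|)%N;
  fedge_sym : symmetric fedge;
  fedge_irr : irreflexive fedge;
  finc_edge : forall x y, finc x y -> fedge x y;
  feps_bnd : forall x, 0 < feps x <= 1;
  frho_sym : forall x y, fedge x y -> frho x y = frho y x;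
  frho_bnd : forall x y, fedge x y -> 0 < frho x y <= 1;
  frho_le : forall x y, fedge x y -> frho x y <= Num.min (feps x) (feps y);
  feta_bnd : forall x y, finc x y -> 0 < feta x y <= 1;
  feta_le : forall x y, finc x y -> feta x y <= Num.min (feps x) (frho x y)
}.

Section FuzzyIncidenceGraph.

Variables (R : realType) (V : finType) (X : fig R V).

(* [s] lists x_1, ..., x_k of a path a = x_0, x_1, ..., x_k = b, (b, ab), ab.
   As k >= 2 and the vertices are distinct, the pair (a, ab) is not used. *)
Definition inc_path (a b : V) (s : seq V) : bool :=
  [&& (2 <= size s)%N,
      path (fun x y => [&& fedge X x y, finc X x y & finc X y x]) a s,
      last a s == b,
      uniq (a :: s),
      fedge X a b
    & finc X b a].

Definition inc_path_weights (a b : V) (s : seq V) : seq R :=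
  rcons (flatten (pairmap (fun x y => [:: feta X x y; feta X y x]) a s))
        (feta X b a).

(* Weights of pairs are at most 1, so the default value 1 does not affect the
   minimum of a nonempty family of them. *)
Definition inc_strength (a b : V) (s : seq V) : R :=
  \big[Num.min/1]_(w <- inc_path_weights a b s) w.

(* A path has distinct vertices, so the bound #|V| on its length is harmless. *)
Definition iconn (a b : V) : R :=
  \big[Num.max/0]_(s : {bseq #|V| of V} | inc_path a b s) inc_strength a b s.

Definition strong_pair (a b : V) : bool :=
  finc X a b && (iconn a b <= feta X a b).

Definition sfig : Prop := forall a b, finc X a b -> strong_pair a b.

Definition strong_nbhd (x : V) : {set V} :=
  [set y | [&& fedge X x y, strong_pair x y & strong_pair y x]].

Definition sids (D : {set V}) : bool :=
  [forall (x | x \notin D), exists y in D, x \in strong_nbhd y].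

Definition min_strong_weight (x : V) : R :=
  if strong_nbhd x == set0 then 0
  else \big[Num.min/1]_(y in strong_nbhd x) feta X x y.

Definition sid_weight (D : {set V}) : R := \sum_(x in D) min_strong_weight x.

(* [setT] is itself a dominating set, so its weight is a legitimate default. *)
Definition sid_number : R :=
  \big[Num.min/sid_weight setT]_(D : {set V} | sids D) sid_weight D.

End FuzzyIncidenceGraph.

Section Composition.

Variables (R : realType) (V1 V2 : finType) (X1 : fig R V1) (X2 : fig R V2).

Implicit Types p q : V1 * V2.

Definition comp_edge p q : bool :=
  (p.1 == q.1) && fedge X2 p.2 q.2 || fedge X1 p.1 q.1.

Definition comp_inc p q : bool :=
  [&& p.1 == q.1, finc X2 p.2 q.2 & finc X2 q.2 p.2]
  || (finc X1 p.1 q.1 && finc X1 q.1 p.1).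

Definition comp_eps p : R := Num.min (feps X1 p.1) (feps X2 p.2).

Definition comp_rho p q : R :=
  if p.1 == q.1 then Num.min (feps X1 p.1) (frho X2 p.2 q.2)
  else if p.2 == q.2 then Num.min (frho X1 p.1 q.1) (feps X2 p.2)
  else Num.min (Num.min (frho X1 p.1 q.1) (feps X2 p.2)) (feps X2 q.2).

Definition comp_eta p q : R :=
  if p.1 == q.1 then Num.min (feps X1 p.1) (feta X2 p.2 q.2)
  else if p.2 == q.2 then Num.min (feta X1 p.1 q.1) (feps X2 p.2)
  else Num.min (Num.min (feta X1 p.1 q.1) (feps X2 p.2)) (feps X2 q.2).

Lemma comp_nonempty : (0 < #|{: V1 * V2}|)%N.
Proof. by rewrite card_prod muln_gt0 (fig_nonempty X1) (fig_nonempty X2). Qed.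

Lemma comp_edge_sym : symmetric comp_edge.
Proof.
by move=> p q; rewrite /comp_edge eq_sym [fedge X2 _ _]fedge_sym
  [fedge X1 _ _]fedge_sym.
Qed.

Lemma comp_edge_irr : irreflexive comp_edge.
Proof. by move=> p; rewrite /comp_edge !fedge_irr andbF. Qed.

Lemma comp_inc_edge p q : comp_inc p q -> comp_edge p q.
Proof.
rewrite /comp_inc /comp_edge => /orP[/and3P[-> /finc_edge -> _] //|].
by case/andP=> /finc_edge -> _; rewrite orbT.
Qed.

Lemma comp_eps_bnd p : 0 < comp_eps p <= 1.
Proof.
have /andP[h1 k1] := feps_bnd X1 p.1; have /andP[h2 k2] := feps_bnd X2 p.2.
by rewrite /comp_eps lt_min h1 h2 ge_min k1.
Qed.

Lemma comp_rho_sym p q : comp_edge p q -> comp_rho p q = comp_rho q p.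
Proof.
rewrite /comp_edge /comp_rho [q.1 == _]eq_sym [q.2 == _]eq_sym.
case: eqP => [-> /=|_ /= e1].
  by rewrite fedge_irr orbF => /frho_sym ->.
by rewrite (frho_sym e1); case: eqP => [->//|_]; rewrite minAC.
Qed.

Lemma comp_rho_bnd p q : comp_edge p q -> 0 < comp_rho p q <= 1.
Proof.
have /andP[h1 k1] := feps_bnd X1 p.1; have /andP[h2 k2] := feps_bnd X2 p.2.
have /andP[h3 k3] := feps_bnd X2 q.2.
rewrite /comp_edge /comp_rho; case: eqP => [-> /=|_ /= /frho_bnd/andP[h4 k4]].
  rewrite fedge_irr orbF => /frho_bnd/andP[h4 k4].
  by rewrite lt_min h4 ge_min k4 orbT (andP (feps_bnd X1 q.1)).1.
by case: eqP => _; rewrite !lt_min ?h2 ?h3 h4 !ge_min k4.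
Qed.

Lemma comp_rho_le p q :
  comp_edge p q -> comp_rho p q <= Num.min (comp_eps p) (comp_eps q).
Proof.
rewrite /comp_edge /comp_rho /comp_eps; case: eqP => [-> /=|_ /= /frho_le].
  rewrite fedge_irr orbF => /frho_le; rewrite le_min => /andP[h k].
  by rewrite !le_min !ge_min lexx h k !orbT.
rewrite le_min => /andP[h k].
by case: eqP => [<-|_]; rewrite !le_min !ge_min lexx h k ?lexx ?orbT.
Qed.

Lemma comp_eta_bnd p q : comp_inc p q -> 0 < comp_eta p q <= 1.
Proof.
have /andP[h2 k2] := feps_bnd X2 p.2; have /andP[h3 k3] := feps_bnd X2 q.2.
rewrite /comp_inc /comp_eta.
case: eqP => [-> /=|_ /= /andP[/feta_bnd/andP[h4 k4] _]].
  have nI : finc X1 q.1 q.1 = false.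
    by apply/negP => /finc_edge; rewrite fedge_irr.
  rewrite nI orbF => /andP[/feta_bnd/andP[h4 k4] _].
  by rewrite lt_min h4 ge_min k4 orbT (andP (feps_bnd X1 q.1)).1.
by case: eqP => _; rewrite !lt_min ?h2 ?h3 h4 !ge_min k4.
Qed.

Lemma comp_eta_le p q :
  comp_inc p q -> comp_eta p q <= Num.min (comp_eps p) (comp_rho p q).
Proof.
rewrite /comp_inc /comp_eta /comp_rho /comp_eps.
case: eqP => [-> /=|_ /= /andP[/feta_le + _]].
  have nI : finc X1 q.1 q.1 = false.
    by apply/negP => /finc_edge; rewrite fedge_irr.
  rewrite nI orbF => /andP[/feta_le + _]; rewrite le_min => /andP[h k].
  by rewrite !le_min !ge_min lexx h k !orbT.
rewrite le_min => /andP[h k].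
by case: eqP => _; rewrite !le_min !ge_min h k ?lexx ?orbT.
Qed.

Definition fig_comp : fig R (V1 * V2)%type :=
  Fig comp_nonempty comp_edge_sym comp_edge_irr comp_inc_edge comp_eps_bnd
    comp_rho_sym comp_rho_bnd comp_rho_le comp_eta_bnd comp_eta_le.

End Composition.

(* Main.v *)
(** In an SFIG every pair is strong, so strong incidence adjacency only requires
    both pairs of the edge to be present, and presence of pairs lifts from the
    factors to the composition.  If [x1] is outside [D1] and [y1] in [D1] dominates
    it in [X1], then [(y1, y2)] dominates [(x1, x2)] for any [y2] in [D2], which is
    nonempty.  If [x1] is in [D1], then [x2] is outside [D2], and
    [(x1, y2)] dominates [(x1, x2)] as soon as [y2] dominates [x2] in [X2]. *)
Require Import Defs.
From mathcomp Require Import all_boot all_order all_algebra.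
From mathcomp Require Import reals.

Set Implicit Arguments.
Unset Strict Implicit.
Unset Printing Implicit Defensive.

Local Open Scope ring_scope.

Lemma strong_nbhd_finc (R : realType) (V : finType) (X : fig R V) (x y : V) :
  y \in strong_nbhd X x -> finc X x y /\ finc X y x.
Proof. by rewrite inE => /and3P[_ /andP[-> _] /andP[-> _]]. Qed.

Lemma sfig_strong_nbhd (R : realType) (V : finType) (X : fig R V) (x y : V) :
  sfig X -> finc X x y -> finc X y x -> y \in strong_nbhd X x.
Proof. by move=> hX xy yx; rewrite inE (finc_edge xy) !hX. Qed.

(** The vertex set is nonempty, and any vertex either lies in [D] or has a dominator in [D]. *)
Lemma sids_neq0 (R : realType) (V : finType) (X : fig R V) (D : {set V}) :
  sids X D -> D != set0.
Proof.
move=> /forall_inP hD; have /card_gt0P[x _] := fig_nonempty X.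
apply/set0Pn; have [xD|/hD/exists_inP[y yD _]] := boolP (x \in D).
  by exists x.
by exists y.
Qed.

Lemma sid_number_le (R : realType) (V : finType) (X : fig R V) (D : {set V}) :
  sids X D -> sid_number X <= sid_weight X D.
Proof. exact: Order.TotalTheory.bigmin_le_cond. Qed.

Lemma sids_comp (R : realType) (V1 V2 : finType) (X1 : fig R V1)
    (X2 : fig R V2) (D1 : {set V1}) (D2 : {set V2}) :
  sfig (fig_comp X1 X2) -> sids X1 D1 -> sids X2 D2 ->
  sids (fig_comp X1 X2) (setX D1 D2).
Proof.
move=> hX /forall_inP hD1 hD2; have /set0Pn[z2 z2D] := sids_neq0 hD2.
move/forall_inP: hD2 => hD2; apply/forall_inP => -[x1 x2].
rewrite in_setX; have [x1D /= /hD2|/hD1 + _] := boolP (x1 \in D1).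
  move=> /exists_inP[y2 y2D /strong_nbhd_finc[yx xy]].
  apply/exists_inP; exists (x1, y2); first by rewrite in_setX x1D.
  (* [comp_inc] asks for both pairs of the edge of [X2] at once, so [yx] and [xy] together settle
     either orientation. *)
  by apply: sfig_strong_nbhd => //; rewrite /= /comp_inc /= eqxx yx xy.
move=> /exists_inP[y1 y1D /strong_nbhd_finc[yx xy]].
(* Pairs lifted from [X1] put no condition on second coordinates, so [z2] may equal [x2] or be
   unrelated to it. *)
apply/exists_inP; exists (y1, z2); first by rewrite in_setX y1D.
by apply: sfig_strong_nbhd => //; rewrite /= /comp_inc /= yx xy orbT.
Qed.

Theorem theorem6p5 (R : realType) (V1 V2 : finType)
    (X1 : fig R V1) (X2 : fig R V2)
    (hX : sfig (fig_comp X1 X2))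
    (D1 : {set V1}) (D2 : {set V2})
    (hD1 : sids X1 D1) (hD2 : sids X2 D2) :
  sids (fig_comp X1 X2) (setX D1 D2) /\
  sid_number (fig_comp X1 X2) <= sid_weight (fig_comp X1 X2) (setX D1 D2).
Proof. by have hD := sids_comp hX hD1 hD2; split; last exact: sid_number_le. Qed.
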